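(* Let $G$ be a compact Lie group, let $\mu$ be the Haar probability measure on $G$, and let $U$ be a finite-dimensional real inner-product space. Let $\rho:G\to\mathrm{End}(U_{\mathbb{C}})$ be the complexification of an orthogonal representation of $G$ on $U$. For $T\in\mathrm{End}(U_{\mathbb{C}})$ define $$\Phi(T)(g):=\langle T,\rho(g)\rangle_{\mathrm{HS}},\qquad \Psi(T):=\Phi(T)-\int_G\Phi(T)(h)\,d\mu(h),$$ and let $\mathcal{C}:=\{T\in\mathrm{End}(U_{\mathbb{C}}):\Phi(T)\text{ is constant on }G\}$. Then for every $T\in\mathrm{End}(U_{\mathbb{C}})$, $$\|\Psi(T)\|_{L^2(G,\mu)}^2\ge\frac{1}{\dim U}\,\|\mathrm{Proj}_{\mathcal{C}^\perp}T\|_{\mathrm{HS}}^2.$$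
   Context: $U_{\mathbb{C}}=U\otimes_{\mathbb{R}}\mathbb{C}$ carries the Hermitian inner product extending that of $U$ (linear in the first argument). $\langle A,B\rangle_{\mathrm{HS}}=\sum_i\langle Ae_i,Be_i\rangle$ for an orthonormal basis $\{e_i\}$ is the Hilbert–Schmidt inner product on $\mathrm{End}(U_{\mathbb{C}})$, with norm $\|\cdot\|_{\mathrm{HS}}$. $\mathcal{C}^\perp$ is the orthogonal complement and $\mathrm{Proj}_{\mathcal{C}^\perp}$ the orthogonal projection with respect to this inner product. Representations are continuous. *)

(* Defs.v *)
From HB Require Import structures.
From mathcomp Require Import all_boot all_order all_algebra.
From mathcomp Require Import sesquilinear complex ring.
From mathcomp Require Import all_classical all_reals all_analysis.

Set Implicit Arguments.
Unset Strict Implicit.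
Unset Printing Implicit Defensive.

Import Order.TTheory GRing.Theory Num.Theory.
Import numFieldNormedType.Exports.

Local Open Scope classical_set_scope.
Local Open Scope ring_scope.

(* For [A] open and [V] finite-dimensional, this is C^k on [A] in the usual
   sense: the partial derivatives of a C^(k+1) map exist and are C^k. *)
Fixpoint class_C (R : realType) (V W : normedModType R) (k : nat)
    (A : set V) (f : V -> W) : Prop :=
  match k with
  | 0 => forall x, A x -> {for x, continuous f}
  | k'.+1 => (forall x, A x -> differentiable f x) /\
             forall v : V, class_C k' A (fun x => 'D_v f x)
  end.

Definition smooth (R : realType) (V W : normedModType R)
    (A : set V) (f : V -> W) : Prop := forall k, class_C k A f.

(* A homeomorphism [chart_fun] from an open set of [G] onto an open set of R^n,
   with inverse [chart_inv]; both functions are total and their values outside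
   [chart_dom], resp. [chart_cod], are irrelevant. *)
Record chart (R : realType) (n : nat) (G : topologicalType) := Chart {
  chart_dom : set G;
  chart_cod : set 'rV[R]_n;
  chart_fun : G -> 'rV[R]_n;
  chart_inv : 'rV[R]_n -> G;
  chart_dom_open : open chart_dom;
  chart_cod_open : open chart_cod;
  chart_fun_cod : forall x, chart_dom x -> chart_cod (chart_fun x);
  chart_inv_dom : forall y, chart_cod y -> chart_dom (chart_inv y);
  chart_funK : forall x, chart_dom x -> chart_inv (chart_fun x) = x;
  chart_invK : forall y, chart_cod y -> chart_fun (chart_inv y) = y;
  chart_fun_continuous : forall x, chart_dom x -> {for x, continuous chart_fun};
  chart_inv_continuous : forall y, chart_cod y -> {for y, continuous chart_inv}
}.

HB.mixin Record isLieGroup (R : realType) (n : nat) G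
    of Group G & PointedTopological G := {
  lie_hausdorff : hausdorff_space G;
  lie_second_countable : @second_countable G;
  lie_mul_continuous : continuous (fun xy : G * G => (xy.1 * xy.2)%g);
  lie_inv_continuous : continuous (fun x : G => (x^-1)%g);
  lie_atlas : set (chart R n G);
  lie_atlas_cover : forall x : G, exists2 a, lie_atlas a & chart_dom a x;
  lie_atlas_smooth : forall a b, lie_atlas a -> lie_atlas b ->
    smooth (chart_cod a `&` (chart_inv a @^-1` chart_dom b))
           (chart_fun b \o chart_inv a);
  lie_mul_smooth : forall a b c, lie_atlas a -> lie_atlas b -> lie_atlas c ->
    let f (p : 'rV[R]_n * 'rV[R]_n) : G :=
      (chart_inv a p.1 * chart_inv b p.2)%g in
    smooth ((chart_cod a `*` chart_cod b) `&` (f @^-1` chart_dom c))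
           (chart_fun c \o f);
  lie_inv_smooth : forall a b, lie_atlas a -> lie_atlas b ->
    let f (p : 'rV[R]_n) : G := ((chart_inv a p)^-1)%g in
    smooth (chart_cod a `&` (f @^-1` chart_dom b)) (chart_fun b \o f)
}.

#[short(type="lieGroupType")]
HB.structure Definition LieGroup (R : realType) (n : nat) :=
  {G of Group G & PointedTopological G & isLieGroup R n G}.

Notation borelType G := (g_sigma_algebraType (@open G)).

(* Regularity needs no mention: on a compact second countable Hausdorff space,
   every Borel probability measure is regular. *)
Definition is_haar (R : realType) (n : nat) (G : lieGroupType R n)
    (mu : probability (borelType G) R) : Prop :=
  forall (g : G) (A : set (borelType G)), measurable A ->
    mu [set (g * x)%g | x in (A : set G)] = mu A.

Definition cintegral d (T : measurableType d) (R : realType)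
    (mu : {measure set T -> \bar R}) (f : T -> R[i]) : R[i] :=
  complex.Complex (Rintegral mu setT (fun x => complex.Re (f x)))
                  (Rintegral mu setT (fun x => complex.Im (f x))).

Definition L2_norm d (T : measurableType d) (R : realType)
    (mu : {measure set T -> \bar R}) (f : T -> R[i]) : \bar R :=
  Lnorm mu 2%:E (fun x => (Normc.normc (f x))%:E).

(* [complexified U] models U (x) C: the pair (u, v) stands for u + i v. *)
Definition complexified (R : realType) (U : vectType R) : Type := (U * U)%type.

Section Complexification.
Import VectorInternalTheory.
Context (R : realType) (U : vectType R).
Local Notation UC := (complexified U).

HB.instance Definition _ := GRing.Zmodule.copy UC (U * U)%type.

Definition cscale (z : R[i]) (x : UC) : UC :=
  (complex.Re z *: x.1 - complex.Im z *: x.2,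
   complex.Re z *: x.2 + complex.Im z *: x.1).

Fact cscaleA a b x : cscale a (cscale b x) = cscale (a * b) x.
Proof.
case: a b x => [a a'] [b b'] [u v].
rewrite -[_ * _]/(Complex (a * b - a' * b') (a * b' + a' * b)) /cscale /=.
rewrite !scalerBr !scalerDr !scalerBl !scalerDl !scalerA.
congr pair; first by rewrite !opprD (AC (2*2) ((1*4)*(2*3))).
by rewrite (AC (2*2) ((1*4)*(2*3))).
Qed.

Fact cscale1 : left_id 1 cscale.
Proof. by case=> u v; rewrite /cscale /= !scale1r !scale0r subr0 addr0. Qed.

Fact cscaleDr : right_distributive cscale +%R.
Proof.
move=> [a a'] [u v] [u' v']; rewrite /cscale /= !scalerDr.
by congr pair; rewrite ?opprD addrACA.
Qed.

Fact cscaleDl x : {morph cscale^~ x : a b / a + b}.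
Proof.
case: x => u v [a a'] [b b']; rewrite /cscale /= !scalerDl.
by congr pair; rewrite ?opprD addrACA.
Qed.

HB.instance Definition _ := GRing.Zmodule_isLmodule.Build R[i] UC
  cscaleA cscale1 cscaleDr cscaleDl.

Fact complexified_vect_axiom : Vector.axiom (dim U) UC.
Proof.
pose f (x : UC) : 'rV[R[i]]_(dim U) :=
  \row_j Complex (v2r x.1 0 j) (v2r x.2 0 j).
exists f.
  move=> [a a'] [u v] [u' v']; apply/rowP => j; rewrite !mxE /=.
  rewrite -[RHS]/(Complex (a * v2r u 0 j - a' * v2r v 0 j + v2r u' 0 j)
                          (a * v2r v 0 j + a' * v2r u 0 j + v2r v' 0 j)).
  by congr Complex; rewrite !linearD ?linearN !linearZ !mxE.
exists (fun y => (r2v (map_mx (@complex.Re R) y),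
                  r2v (map_mx (@complex.Im R) y)) : UC).
  move=> [u v]; rewrite /f; congr pair; apply: (can_inj v2rK);
    by rewrite r2vK; apply/rowP => j; rewrite !mxE.
by move=> y; apply/rowP => j; rewrite !mxE /= !r2vK !mxE; case: (y 0 j).
Qed.

HB.instance Definition _ := Lmodule_hasFinDim.Build R[i] UC
  complexified_vect_axiom.

(* The Hermitian extension of the inner product of U:
   <u + iv, u' + iv'> = <u, u'> + <v, v'> + i (<v, u'> - <u, v'>). *)
Definition hdot (dot : {dot U for idfun}) (x y : UC) : R[i] :=
  Complex (dot x.1 y.1 + dot x.2 y.2) (dot x.2 y.1 - dot x.1 y.2).

Section HermitianForm.
Variable dot : {dot U for idfun}.

Fact hdot_bilinear : bilinear_for
  (GRing.Scale.Law.clone _ _ *%R _)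
  (GRing.Scale.Law.clone _ _ (Num.conj \; *%R) _) (hdot dot).
Proof.
split=> [[w w']|[w w']] [a a'] [u u'] [v v'] /=.
  rewrite -[RHS]/(Complex
    (a * (dot u w + dot u' w') - a' * (dot u' w - dot u w')
       + (dot v w + dot v' w'))
    (a * (dot u' w - dot u w') + a' * (dot u w + dot u' w')
       + (dot v' w - dot v w'))) /hdot /=.
  by congr Complex; rewrite !linearDl ?linearNl !linearZl_LR /=; ring.
rewrite -[RHS]/(Complex
    (a * (dot w u + dot w' u') - - a' * (dot w' u - dot w u')
       + (dot w v + dot w' v'))
    (a * (dot w' u - dot w u') + - a' * (dot w u + dot w' u')
       + (dot w' v - dot w v'))) /hdot /=.
by congr Complex; rewrite !linearDr ?linearNr !linearZr_LR /=; ring.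
Qed.

HB.instance Definition _ := bilinear_isBilinear.Build R[i] UC UC R[i]
  (GRing.Scale.Law.clone _ _ *%R _)
  (GRing.Scale.Law.clone _ _ (Num.conj \; *%R) _) (hdot dot) hdot_bilinear.

Fact hdot_hermitian (x y : UC) :
  hdot dot x y = (-1) ^+ false * Num.conj (hdot dot y x).
Proof.
have dotC u v : dot u v = dot v u by rewrite hermC expr0 mul1r.
rewrite expr0 mul1r -[RHS]/(Complex (dot y.1 x.1 + dot y.2 x.2)
  (- (dot y.2 x.1 - dot y.1 x.2))) /hdot opprB.
by rewrite !(dotC y.1) !(dotC y.2).
Qed.

HB.instance Definition _ := isHermitianSesquilinear.Build R[i] UC false
  Num.conj (hdot dot) hdot_hermitian.

Fact hdot_gt0 (x : UC) : x != 0 -> 0 < hdot dot x x.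
Proof.
have dotC u v : dot u v = dot v u by rewrite hermC expr0 mul1r.
have dot_ge0 u : 0 <= dot u u.
  by have [->|/neq0_dnorm_gt0/ltW//] := eqVneq u 0; rewrite linear0r.
case: x => u v; rewrite /hdot /= (dotC v u) subrr => x0; rewrite ltcE /= eqxx /=.
have [u0|/neq0_dnorm_gt0 u_gt0] := eqVneq u 0.
  rewrite ltr_wpDl// neq0_dnorm_gt0//; apply: contraNneq x0 => v0.
  by rewrite u0 v0.
by rewrite ltr_wpDr.
Qed.

HB.instance Definition _ := isDotProduct.Build R[i] UC (hdot dot) hdot_gt0.

End HermitianForm.

Definition complexify_fun (f : 'End(U)) (x : UC) : UC := (f x.1, f x.2).

Fact complexify_fun_linear f : linear (complexify_fun f).
Proof.
move=> a [u u'] [v v'].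
by congr pair; rewrite /= !linearD ?linearN !linearZ.
Qed.

HB.instance Definition _ f := GRing.isLinear.Build R[i] UC UC _
  (complexify_fun f) (complexify_fun_linear f).

Definition complexify (f : 'End(U)) : 'End(UC) := linfun (complexify_fun f).

End Complexification.

Section HilbertSchmidt.
Context (R : realType) (V : vectType R[i]) (form : {dot V for Num.conj}).

Definition is_orthonormal_basis (e : seq V) : bool :=
  basis_of fullv e && orthonormal form e.

(* [e] is meant to be an orthonormal basis of V. *)
Definition hs_dot (e : seq V) (A B : 'End(V)) : R[i] :=
  \sum_(x <- e) form (A x) (B x).

Definition hs_norm (e : seq V) (A : 'End(V)) : R :=
  Num.sqrt (complex.Re (hs_dot e A A)).

Definition hs_orth (e : seq V) (W : set 'End(V)) : set 'End(V) :=
  [set S | forall A, W A -> hs_dot e S A = 0].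

(* When W is a subspace there is exactly one such P, by finite dimension, and
   the default value 0 is not used. *)
Definition hs_proj (e : seq V) (W : set 'End(V)) (T : 'End(V)) : 'End(V) :=
  xget 0 [set P | W P /\ hs_orth e W (T - P)].

End HilbertSchmidt.

(* Continuity is that of r : G -> End(U) for the operator norm of End(U). *)
Record orthogonal_representation (R : realType) (n : nat) (G : lieGroupType R n)
    (U : vectType R) (dot : {dot U for idfun}) (r : G -> 'End(U)) : Prop := {
  repr1 : r 1%g = \1%VF;
  reprM : forall g h, r (g * h)%g = (r g \o r h)%VF;
  repr_isometry : forall g u v, dot (r g u) (r g v) = dot u v;
  repr_continuous : forall (g : G) (eps : R), 0 < eps ->
    \forall h \near g, forall u,
      Num.sqrt (dot (r h u - r g u) (r h u - r g u)) <=
      eps * Num.sqrt (dot u u)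
}.

Section FourierMap.
Context (R : realType) (n : nat) (G : lieGroupType R n)
  (mu : probability (borelType G) R)
  (V : vectType R[i]) (form : {dot V for Num.conj}) (e : seq V)
  (rho : G -> 'End(V)).

Definition Phi (T : 'End(V)) (g : G) : R[i] := hs_dot form e T (rho g).

Definition Psi (T : 'End(V)) (g : G) : R[i] :=
  Phi T g - cintegral mu (Phi T).

Definition constant_set : set 'End(V) :=
  [set T | exists c, forall g, Phi T g = c].

End FourierMap.

(* Main.v *)
(* Write P for the mean of rho, the projection onto the invariant vectors, and
   N(g) = rho(g) - P.  Then N(gh) = N(g) N(h), N(g^-1) = N(g)^*, and
   Psi(T)(g) = <T, N(g)>, so the orthogonal complement of the space of T with
   Phi(T) constant is the span of the N(g).  For T in that span, translation
   invariance gives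
     E |<T, N>|^2 = E (conj (tr N) tr (T N T^* )) = sum_ij <Q X_ij, X_ij>,
   with X_ij = T^* E_ij and Q X = E (N X N^* ) the orthogonal projection onto the
   matrices fixed by conjugation.  The projection K = N(1) is such a fixed
   matrix, of squared norm tr K <= dim U, so Cauchy-Schwarz bounds the sum below
   by sum_ij |<X_ij, K>|^2 / tr K = |T|^2 / tr K.  This is the bound that Schur
   orthogonality gives, without decomposing rho into irreducibles. *)

Require Import Defs.
From HB Require Import structures.
From mathcomp Require Import all_boot all_order all_algebra.
From mathcomp Require Import sesquilinear complex ring.
From mathcomp Require Import all_classical all_reals all_analysis.
From mathcomp Require Import measurable_realfun.

Set Implicit Arguments.
Unset Strict Implicit.
Unset Printing Implicit Defensive.

Import Order.TTheory GRing.Theory Num.Theory.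
Import numFieldNormedType.Exports.

Local Open Scope classical_set_scope.
Local Open Scope ring_scope.

(** * Matrices and their adjoints *)

Section DoubleOrthogonal.
Variables (F : fieldType) (I : Type) (m : nat) (f : I -> 'rV[F]_m).

Definition rows_mx (s : seq I) : 'M[F]_(size s, m) :=
  \matrix_(k < size s) nth 0 [seq f i | i <- s] k.

Lemma rows_mx_cons i s :
  (f i <= rows_mx (i :: s))%MS && (rows_mx s <= rows_mx (i :: s))%MS.
Proof.
apply/andP; split.
  by rewrite -(_ : row ord0 (rows_mx (i :: s)) = f i) ?row_sub// rowK.
apply/row_subP => k; rewrite rowK.
rewrite -(_ : row (lift ord0 k) (rows_mx (i :: s)) = nth 0 [seq f i | i <- s] k).
  exact: row_sub.
by rewrite rowK.
Qed.

(** [I] is arbitrary, possibly infinite or empty. A list that does not yet span can be extended by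
    one index with a strict gain in rank, and the rank never exceeds [m]. *)
Lemma finite_row_span : exists s : seq I, forall i, (f i <= rows_mx s)%MS.
Proof.
suff H r : (exists s, forall i, (f i <= rows_mx s)%MS) \/
    exists s, (r <= \rank (rows_mx s))%N.
  by have [//|[s]] := H m.+1; rewrite leqNgt ltnS rank_leq_col.
elim: r => [|r [|[s rs]]]; [by right; exists [::]|by left|].
have [|] := pselect (forall i, (f i <= rows_mx s)%MS); first by left; exists s.
move=> /existsNP[i /negP fi]; right; exists (i :: s).
have /andP[fi' ss'] := rows_mx_cons i s.
apply: leq_ltn_trans rs _; apply: rank_ltmx; rewrite ltmxE ss'/=.
by apply: contra fi; apply: submx_trans.
Qed.

(** The columns of [cokermx (rows_mx s)] annihilate every [f i], hence also [v]; this puts [v] in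
    the row space of [rows_mx s]. *)
Lemma row_double_annihilator (v : 'rV[F]_m) :
  (forall y : 'cV[F]_m, (forall i, f i *m y = 0) -> v *m y = 0) ->
  exists s : seq (F * I), v = \sum_(ci <- s) ci.1 *: f ci.2.
Proof.
have [s fs] := finite_row_span => ann.
have vs : (v <= rows_mx s)%MS.
  rewrite submxE; apply/eqP/matrixP => i j; rewrite ord1.
  have : col j (v *m cokermx (rows_mx s)) = 0.
    rewrite colE -mulmxA -colE; apply: ann => k; have := fs k.
    by rewrite submxE colE mulmxA => /eqP ->; rewrite mul0mx.
  by move=> /colP/(_ 0); rewrite [LHS]mxE [RHS]mxE => ->; rewrite mxE.
have [D ->] := submxP vs; rewrite mulmx_sum_row.
(* As [I] may be empty, the default index for [nth] is taken from [s] itself; for empty [s] the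
   combination is the empty sum. *)
have [s0|[i0 _]] : s = [::] \/ exists _ : I, True.
  by case: s {fs vs D} => [|i]; [left|right; exists i].
  by exists [::]; move: D; rewrite s0 => D; rewrite big_nil big_ord0.
exists [seq (D 0 k, nth i0 s k) | k <- index_enum 'I_(size s)].
rewrite big_map; apply: eq_bigr => k _ /=.
by rewrite rowK (nth_map i0).
Qed.

End DoubleOrthogonal.

Section Adjoint.
Variable C : numClosedFieldType.

Definition adjmx m n (A : 'M[C]_(m, n)) : 'M[C]_(n, m) := map_mx Num.conj A^T.

Lemma adjmxE m n (A : 'M[C]_(m, n)) i j : adjmx A i j = (A j i)^*.
Proof. by rewrite !mxE. Qed.

Lemma adjmxK m n (A : 'M[C]_(m, n)) : adjmx (adjmx A) = A.
Proof. by apply/matrixP => i j; rewrite !adjmxE conjCK. Qed.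

Lemma adjmxM m n p (A : 'M[C]_(m, n)) (B : 'M[C]_(n, p)) :
  adjmx (A *m B) = adjmx B *m adjmx A.
Proof. by rewrite /adjmx trmx_mul map_mxM. Qed.

Lemma adjmxB m n (A B : 'M[C]_(m, n)) : adjmx (A - B) = adjmx A - adjmx B.
Proof. by rewrite /adjmx raddfB/= map_mxB. Qed.

Lemma trace_adj n (A : 'M[C]_n) : \tr (adjmx A) = (\tr A)^*.
Proof. by rewrite /mxtrace rmorph_sum; apply: eq_bigr => i _; rewrite adjmxE. Qed.

Lemma trace_mul_adj m n (A B : 'M[C]_(m, n)) :
  \tr (A *m adjmx B) = \sum_i \sum_j A i j * (B i j)^*.
Proof.
by apply: eq_bigr => i _; rewrite !mxE; apply: eq_bigr => j _; rewrite adjmxE.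
Qed.

Lemma trace_mul_adj_ge0 m n (A : 'M[C]_(m, n)) : 0 <= \tr (A *m adjmx A).
Proof.
by rewrite trace_mul_adj; apply: sumr_ge0 => i _; apply: sumr_ge0 => j _;
  rewrite mul_conjC_ge0.
Qed.

Lemma trace_mul_adj_eq0 m n (A : 'M[C]_(m, n)) : \tr (A *m adjmx A) = 0 -> A = 0.
Proof.
rewrite trace_mul_adj => /psumr_eq0P A0; apply/matrixP => i j; rewrite mxE.
have /psumr_eq0P : \sum_j A i j * (A i j)^* = 0.
  by apply: A0 => // k _; apply: sumr_ge0 => l _; rewrite mul_conjC_ge0.
move=> /(_ (fun k _ => mul_conjC_ge0 _) j isT) /eqP.
by rewrite mul_conjC_eq0 => /eqP.
Qed.

Lemma trace_CauchySchwarz m n (A B : 'M[C]_(m, n)) :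
  `|\tr (A *m adjmx B)| ^+ 2 <= \tr (A *m adjmx A) * \tr (B *m adjmx B).
Proof.
have [/trace_mul_adj_eq0 ->|B0] := eqVneq (\tr (B *m adjmx B)) 0.
  by rewrite /adjmx trmx0 map_mx0 mulmx0 mul0mx !mxtrace0 normr0 expr0n/= mulr0.
have Bgt0 : 0 < \tr (B *m adjmx B) by rewrite lt_def B0 trace_mul_adj_ge0.
set b := \tr (B *m adjmx B) in B0 Bgt0 *; set t := \tr (A *m adjmx B).
have tBA : \tr (B *m adjmx A) = t^*.
  by rewrite -trace_adj adjmxM adjmxK.
have bR : b^* = b by rewrite -trace_adj adjmxM adjmxK.
(* The squared norm of this combination is [b] times the difference of the two sides of the
   claim. *)
have := trace_mul_adj_ge0 (b *: A - t *: B).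
have -> : adjmx (b *: A - t *: B) = b *: adjmx A - t^* *: adjmx B.
  by apply/matrixP => i j; rewrite !mxE rmorphB !rmorphM/= bR.
rewrite mulmxBl !mulmxBr -!scalemxAl -!scalemxAr !raddfB/= !mxtraceZ tBA -/b -/t.
rewrite [X in 0 <= X -> _](_ : _ = b * (\tr (A *m adjmx A) * b - t * t^*));
  last by ring.
by rewrite pmulr_rge0// subr_ge0 normCK.
Qed.

End Adjoint.
(** * Invariant means and unitary representations *)

(** An algebraic model of Haar integration: [D] is a conjugation-stable algebra of functions on
    which [E] is linear and left invariant. Bounded measurable functions with [cintegral] are the
    intended instance. *)
Record invariant_mean (C : numClosedFieldType) (G : groupType)
    (D : (G -> C) -> Prop) (E : (G -> C) -> C) : Prop := InvariantMean {
  dom_cst : forall c, D (fun=> c);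
  dom_add : forall f g, D f -> D g -> D (fun x => f x + g x);
  dom_mul : forall f g, D f -> D g -> D (fun x => f x * g x);
  dom_conj : forall f, D f -> D (fun x => (f x)^*);
  mean_cst : forall c, E (fun=> c) = c;
  mean_add : forall f g, D f -> D g -> E (fun x => f x + g x) = E f + E g;
  mean_scale : forall c f, D f -> E (fun x => c * f x) = c * E f;
  mean_conj : forall f, D f -> E (fun x => (f x)^*) = (E f)^*;
  mean_shift : forall h f, D f -> E (fun x => f (h * x)%g) = E f
}.

Lemma mulmx_delta_mulmx (R : pzRingType) m n p q (A : 'M[R]_(m, n))
    (B : 'M[R]_(p, q)) i j k l : (A *m delta_mx i j *m B) k l = A k i * B j l.
Proof.
rewrite -(mul_delta_mx (0 : 'I_1)) mulmxA -mulmxA -colE -rowE mxE big_ord1.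
by rewrite mxE [row _ _ _ _]mxE.
Qed.

Lemma trace_mul_delta (R : comPzRingType) m n (A : 'M[R]_(m, n)) i j :
  \tr (A *m delta_mx i j) = A j i.
Proof.
rewrite mxtrace_mulC -(mul_delta_mx (0 : 'I_1)) -mulmxA -rowE mxtrace_mulC -colE.
by rewrite /mxtrace big_ord1 mxE [row _ _ _ _]mxE.
Qed.

Section InvariantMean.
Variables (C : numClosedFieldType) (G : groupType).
Variables (D : (G -> C) -> Prop) (E : (G -> C) -> C).
Hypothesis DE : invariant_mean D E.

Lemma eq_mean f g : f =1 g -> E f = E g.
Proof. by move=> /funext->. Qed.

Lemma eq_dom f g : D g -> f =1 g -> D f.
Proof. by move=> Dg /funext->. Qed.

Lemma dom_sum I (r : seq I) (F : I -> G -> C) :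
  (forall i, D (F i)) -> D (fun x => \sum_(i <- r) F i x).
Proof.
move=> DF; elim: r => [|i r IH].
  apply: (@eq_dom _ (fun=> 0)); first exact: (dom_cst DE).
  by move=> x; rewrite big_nil.
apply: eq_dom (dom_add DE (DF i) IH) _ => x.
by rewrite big_cons.
Qed.

Lemma mean_sum I (r : seq I) (F : I -> G -> C) :
  (forall i, D (F i)) ->
  E (fun x => \sum_(i <- r) F i x) = \sum_(i <- r) E (F i).
Proof.
move=> DF; elim: r => [|i r IH].
  by rewrite big_nil -[RHS](mean_cst DE); apply: eq_mean => x; rewrite big_nil.
rewrite big_cons -IH -(mean_add DE)//; last exact: dom_sum.
by apply: eq_mean => x; rewrite big_cons.
Qed.

Definition mx_dom m n (F : G -> 'M[C]_(m, n)) := forall i j, D (fun x => F x i j).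
Definition mx_mean m n (F : G -> 'M[C]_(m, n)) : 'M[C]_(m, n) :=
  \matrix_(i, j) E (fun x => F x i j).

Lemma eq_mx_mean m n (F F' : G -> 'M[C]_(m, n)) :
  F =1 F' -> mx_mean F = mx_mean F'.
Proof. by move=> /funext->. Qed.

Lemma mx_dom_cst m n (A : 'M[C]_(m, n)) : mx_dom (fun=> A).
Proof. by move=> i j; apply: (dom_cst DE). Qed.

Lemma mx_dom_mul m n p (F : G -> 'M[C]_(m, n)) (F' : G -> 'M[C]_(n, p)) :
  mx_dom F -> mx_dom F' -> mx_dom (fun x => F x *m F' x).
Proof.
move=> DF DF' i j.
apply: (@eq_dom _ (fun x => \sum_k F x i k * F' x k j)) => [|x].
  by apply: dom_sum => k; apply: (dom_mul DE).
by rewrite mxE.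
Qed.

Lemma mx_dom_adj m n (F : G -> 'M[C]_(m, n)) :
  mx_dom F -> mx_dom (fun x => adjmx (F x)).
Proof.
by move=> DF i j; apply: eq_dom (dom_conj DE (DF j i)) _ => x; rewrite adjmxE.
Qed.

Lemma dom_trace n (F : G -> 'M[C]_n) : mx_dom F -> D (fun x => \tr (F x)).
Proof. by move=> DF; apply: dom_sum. Qed.

Lemma mx_mean_cst m n (A : 'M[C]_(m, n)) : mx_mean (fun=> A) = A.
Proof. by apply/matrixP => i j; rewrite mxE (mean_cst DE). Qed.

Lemma mx_meanMl m n p (A : 'M[C]_(m, n)) (F : G -> 'M[C]_(n, p)) : mx_dom F ->
  mx_mean (fun x => A *m F x) = A *m mx_mean F.
Proof.
move=> DF; apply/matrixP => i j; rewrite !mxE; under eq_mean do rewrite mxE.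
rewrite mean_sum; last first.
  by move=> k; apply: (dom_mul DE) => //; apply: (dom_cst DE).
by apply: eq_bigr => k _; rewrite (mean_scale DE)// mxE.
Qed.

Lemma mx_meanMr m n p (F : G -> 'M[C]_(m, n)) (A : 'M[C]_(n, p)) : mx_dom F ->
  mx_mean (fun x => F x *m A) = mx_mean F *m A.
Proof.
move=> DF; apply/matrixP => i j; rewrite !mxE; under eq_mean do rewrite mxE.
rewrite mean_sum; last first.
  by move=> k; apply: (dom_mul DE) => //; apply: (dom_cst DE).
apply: eq_bigr => k _; rewrite mxE mulrC -(mean_scale DE)//.
by under eq_mean do rewrite mulrC.
Qed.

Lemma mx_mean_adj m n (F : G -> 'M[C]_(m, n)) : mx_dom F ->
  mx_mean (fun x => adjmx (F x)) = adjmx (mx_mean F).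
Proof.
move=> DF; apply/matrixP => i j; rewrite adjmxE !mxE -(mean_conj DE)//.
by under eq_mean do rewrite adjmxE.
Qed.

Lemma mx_mean_shift m n h (F : G -> 'M[C]_(m, n)) : mx_dom F ->
  mx_mean (fun x => F (h * x)%g) = mx_mean F.
Proof.
by move=> DF; apply/matrixP => i j; rewrite !mxE (mean_shift DE h (DF i j)).
Qed.

Lemma mean_trace n (F : G -> 'M[C]_n) : mx_dom F ->
  E (fun x => \tr (F x)) = \tr (mx_mean F).
Proof.
by move=> DF; rewrite /mxtrace mean_sum//; apply: eq_bigr => i _; rewrite mxE.
Qed.

(** * The mean of a unitary representation as a projection *)

Section FixedProjection.
Variables (d : nat) (M : G -> 'M[C]_d).
Hypotheses (DM : mx_dom M) (MM : forall g h, M (g * h)%g = M g *m M h).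
Hypothesis MV : forall g, M (g^-1)%g = adjmx (M g).
Local Notation P := (mx_mean M).

Lemma mulmx_mean h : M h *m P = P.
Proof.
by rewrite -mx_meanMl// -[RHS](mx_mean_shift h)//; apply: eq_mx_mean => x.
Qed.

(** Averaging [M(x)^* P = M(x^-1) P = P] gives [P^* P = P], whose left side is self-adjoint. This
    route uses only left invariance of the mean. *)
Lemma adj_mean : adjmx P = P.
Proof.
suff <- : adjmx P *m P = P by rewrite adjmxM adjmxK.
rewrite -mx_mean_adj// -mx_meanMr; last exact: mx_dom_adj.
rewrite -[RHS]mx_mean_cst; apply: eq_mx_mean => x.
by rewrite -MV mulmx_mean.
Qed.

(** The adjoint of [mulmx_mean] at the inverse of [h]. *)
Lemma mean_mulmx h : P *m M h = P.
Proof. by rewrite -[M h]adjmxK -MV -{1}adj_mean -adjmxM mulmx_mean adj_mean. Qed.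

Lemma mean_idem : P *m P = P.
Proof.
rewrite -{3}[P]mx_mean_cst -mx_meanMl//.
by apply: eq_mx_mean => x; rewrite mean_mulmx.
Qed.

Lemma centered_mul g h : M (g * h)%g - P = (M g - P) *m (M h - P).
Proof.
rewrite mulmxBl !mulmxBr mean_mulmx mulmx_mean mean_idem -MM.
by rewrite subrr subr0.
Qed.

Lemma centered_inv g : M (g^-1)%g - P = adjmx (M g - P).
Proof. by rewrite adjmxB adj_mean MV. Qed.

End FixedProjection.

(** * Lower bound for the mean square of Frobenius coefficients *)

Section SpectralGap.
Variables (d : nat) (N : G -> 'M[C]_d).
Hypotheses (DN : mx_dom N) (NM : forall g h, N (g * h)%g = N g *m N h).
Hypothesis NV : forall g, N (g^-1)%g = adjmx (N g).
Local Notation K := (N 1%g).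

(** [K] is an orthogonal projection, and [N] acts unitarily on its image. For a centered
    representation it is [M 1 - P]. *)
Let adjK1 : adjmx K = K. Proof. by rewrite -NV invg1. Qed.
Let KK : K *m K = K. Proof. by rewrite -NM mulg1. Qed.
Let NK g : N g *m K = N g. Proof. by rewrite -NM mulg1. Qed.

(** A diagonal entry of an orthogonal projection is the squared norm of its row, so it dominates its
    own square and is at most 1. This is where the factor [dim U] of the theorem originates. *)
Lemma unit_trace_le : \tr K <= d%:R.
Proof.
rewrite -[d in d%:R]card_ord -sumr_const; apply: ler_sum => i _.
have K0 j : 0 <= `|K i j| ^+ 2 by rewrite exprn_ge0.
have Kii : K i i = \sum_j `|K i j| ^+ 2.
  rewrite -{1}KK mxE; apply: eq_bigr => j _.
  by rewrite normCK; congr (_ * _); rewrite -{1}adjK1 adjmxE.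
have Kii2 : K i i ^+ 2 <= K i i.
  rewrite {2}Kii (bigD1 i)//= ger0_norm ?lerDl ?sumr_ge0//.
  by rewrite Kii sumr_ge0.
(* Both summands are nonnegative, and the sum collapses to [1 - K i i]. *)
have : 0 <= (1 - K i i) ^+ 2 + (K i i - K i i ^+ 2).
  rewrite addr_ge0 ?subr_ge0// real_exprn_even_ge0// rpredB ?rpred1//.
  by rewrite Kii ger0_real// sumr_ge0.
have -> : (1 - K i i) ^+ 2 + (K i i - K i i ^+ 2) = 1 - K i i by ring.
by rewrite subr_ge0.
Qed.

(* [X |-> E (N X N^* )] is the orthogonal projection onto the matrices fixed by
   conjugation; [K] is one of them. *)
Lemma conj_mean_ge (X : 'M[C]_d) :
  let q := E (fun x => \tr (N x *m X *m adjmx (N x) *m adjmx X)) in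
  0 <= q /\ `|\tr (X *m K)| ^+ 2 <= \tr K * q.
Proof.
move=> q; have DX : mx_dom (fun x => N x *m X *m adjmx (N x)).
  apply: mx_dom_mul; last exact: mx_dom_adj.
  by apply: mx_dom_mul => //; apply: mx_dom_cst.
pose Y := mx_mean (fun x => N x *m X *m adjmx (N x)).
(* Conjugating by [N h] only shifts the averaging variable from [x] to [h * x]. *)
have NY h : N h *m Y *m adjmx (N h) = Y.
  rewrite -mx_meanMl// -mx_meanMr; last first.
    by apply: mx_dom_mul => //; apply: mx_dom_cst.
  rewrite -[RHS](mx_mean_shift h)//; apply: eq_mx_mean => x.
  by rewrite NM adjmxM !mulmxA.
have DXA A : mx_dom (fun x => N x *m X *m adjmx (N x) *m A).
  by apply: mx_dom_mul => //; apply: mx_dom_cst.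
have YX : E (fun x => \tr (N x *m X *m adjmx (N x) *m adjmx X)) =
    \tr (Y *m adjmx X).
  by rewrite mean_trace// mx_meanMr.
(* By cyclicity of the trace, the averaging moves from [X] to the test matrix [A]; it leaves
   unchanged any [A] fixed by conjugation. *)
have YA A : \tr (Y *m A) = \tr (X *m mx_mean (fun x => adjmx (N x) *m A *m N x)).
  have DA : mx_dom (fun x => adjmx (N x) *m A *m N x).
    apply: mx_dom_mul => //; apply: mx_dom_mul; last exact: mx_dom_cst.
    exact: mx_dom_adj.
  rewrite -mx_meanMr// -mx_meanMl// -!mean_trace//; last first.
    by apply: mx_dom_mul => //; apply: mx_dom_cst.
  apply: eq_mean => x; rewrite -!mulmxA mxtrace_mulC !mulmxA.
  by rewrite -!mulmxA.
(* Apply [YA] to the fixed matrix [adjmx Y], then conjugate: [X - Y] is orthogonal to [Y]. Hence [q]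
   is the squared norm of [Y]. *)
have YY : \tr (Y *m adjmx X) = \tr (Y *m adjmx Y).
  have YXY : \tr (X *m adjmx Y) = \tr (Y *m adjmx Y).
    rewrite [RHS]YA (_ : mx_mean _ = adjmx Y)// -[RHS]mx_mean_cst.
    apply: eq_mx_mean => x.
    rewrite -{1}NV -[N x in LHS]adjmxK -[adjmx (N x) in LHS]NV.
    by rewrite -{2}(NY (x^-1)%g) !adjmxM !mulmxA adjmxK.
  apply: etrans (_ : (\tr (X *m adjmx Y))^* = _).
    by rewrite -trace_adj adjmxM adjmxK.
  by rewrite YXY -trace_adj adjmxM adjmxK.
have YK : \tr (Y *m adjmx K) = \tr (X *m K).
  rewrite YA (_ : mx_mean _ = K)// -[RHS]mx_mean_cst; apply: eq_mx_mean => x.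
  by rewrite adjK1 -mulmxA -NM mul1g -NV -NM mulVg.
rewrite -YK /q YX YY; split; first exact: trace_mul_adj_ge0.
(* For a projection the trace is the squared norm, so the claim is Cauchy-Schwarz for [Y] and
   [K]. *)
rewrite mulrC (_ : \tr K = \tr (K *m adjmx K)); last by rewrite adjK1 KK.
exact: trace_CauchySchwarz.
Qed.

(** By linearity in one copy of [T] it is enough to treat [N h] in its place, where translating by
    [h] gives the identity. *)
Lemma mean_frob_span (s : seq (C * G)) (T : 'M[C]_d) :
  T = \sum_(ch <- s) ch.1 *: N ch.2 ->
  E (fun x => \tr (T *m adjmx (N x)) * (\tr (T *m adjmx (N x)))^*) =
  E (fun x => (\tr (N x))^* * \tr (T *m N x *m adjmx T)).
Proof.
move=> Ts.
have DT (A B : 'M[C]_d) : D (fun x => \tr (A *m N x *m B)).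
  apply: dom_trace; apply: mx_dom_mul; last exact: mx_dom_cst.
  by apply: mx_dom_mul => //; apply: mx_dom_cst.
have DT' (A B : 'M[C]_d) : D (fun x => (\tr (A *m N x *m B))^*).
  by apply: (dom_conj DE).
(* Only the first copy of [T] is expanded along [s]; the conjugated one stays whole. *)
pose F h x := \tr (N h *m adjmx (N x)) * (\tr (T *m adjmx (N x)))^*.
have trE A x : \tr (A *m adjmx (N x)) = (\tr (1%:M *m N x *m adjmx A))^*.
  by rewrite -trace_adj mul1mx adjmxM adjmxK.
have DF h : D (F h).
  apply: (dom_mul DE).
    by apply: eq_dom (DT' 1%:M (adjmx (N h))) _ => x; rewrite trE.
  by apply: eq_dom (DT 1%:M (adjmx T)) _ => x; rewrite trE conjCK.
pose F' h x := (\tr (N x))^* * \tr (N h *m N x *m adjmx T).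
have DF' h : D (F' h).
  apply: (dom_mul DE) (DT _ _).
  by apply: eq_dom (DT' 1%:M 1%:M) _ => x; rewrite mulmx1 mul1mx.
have FF' h : E (F h) = E (F' h).
  (* After replacing [x] by [h * x], the first factor contains [adjmx (N h) *m N h], which is [K]
     and is absorbed; in the second, [N (h * x)] splits. *)
  rewrite -(mean_shift DE h (DF h)); apply: eq_mean => x; rewrite /F /F'.
  congr (_ * _).
    rewrite NM adjmxM mulmxA mxtrace_mulC mulmxA -NV -NM mulVg -adjK1 -adjmxM.
    by rewrite NK trace_adj.
  by rewrite trE conjCK mul1mx NM.
transitivity (\sum_(ch <- s) ch.1 * E (F ch.2)).
  under [RHS]eq_bigr do rewrite -(mean_scale DE)//.
  rewrite -mean_sum; last first.
    by move=> i; apply: (dom_mul DE) => //; apply: (dom_cst DE).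
  apply: eq_mean => x; rewrite /F {1}Ts mulmx_suml raddf_sum/= mulr_suml.
  by apply: eq_bigr => ch _; rewrite -scalemxAl mxtraceZ mulrA.
under eq_bigr do rewrite FF' -(mean_scale DE)//.
rewrite -mean_sum; last first.
  by move=> i; apply: (dom_mul DE) => //; apply: (dom_cst DE).
apply: eq_mean => x; rewrite /F'.
have -> : \tr (T *m N x *m adjmx T) =
    \sum_(ch <- s) ch.1 * \tr (N ch.2 *m N x *m adjmx T).
  rewrite {1}Ts !mulmx_suml raddf_sum; apply: eq_bigr => ch _.
  by rewrite -!scalemxAl/= mxtraceZ.
by rewrite mulr_sumr; apply: eq_bigr => ch _; rewrite mulrCA.
Qed.

(** The mean is a sum of the quantities of [conj_mean_ge] over the matrices [X i j]; bounding each
    of them recovers the squared norm of [T] up to [\tr K]. *)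
Lemma frob_mean_ge (s : seq (C * G)) (T : 'M[C]_d) :
  T = \sum_(ch <- s) ch.1 *: N ch.2 ->
  \tr (T *m adjmx T) <=
    d%:R * E (fun x => \tr (T *m adjmx (N x)) * (\tr (T *m adjmx (N x)))^*).
Proof.
move=> Ts; have TK : T *m K = T.
  rewrite Ts mulmx_suml; apply: eq_bigr => ch _.
  by rewrite -scalemxAl NK.
rewrite (mean_frob_span Ts).
pose X i j : 'M[C]_d := adjmx T *m delta_mx i j.
pose Q i j := E (fun x => \tr (N x *m X i j *m adjmx (N x) *m adjmx (X i j))).
have DQ i j : D (fun x => \tr (N x *m X i j *m adjmx (N x) *m adjmx (X i j))).
  apply: dom_trace; apply: mx_dom_mul; last exact: mx_dom_cst.
  apply: mx_dom_mul; last exact: mx_dom_adj.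
  by apply: mx_dom_mul => //; apply: mx_dom_cst.
(* The term of index [i], [j] is the [i]-th diagonal entry of [T N T^*] times the conjugate of the
   [j]-th diagonal entry of [N], so the double sum factors into two traces. *)
have -> : E (fun x => (\tr (N x))^* * \tr (T *m N x *m adjmx T)) =
    \sum_i \sum_j Q i j.
  under eq_bigr do rewrite -mean_sum//.
  rewrite -mean_sum; last by move=> i; apply: dom_sum.
  apply: eq_mean => x; rewrite -trace_adj mulrC mulr_suml.
  apply: eq_bigr => i _; rewrite mulr_sumr; apply: eq_bigr => j _.
  rewrite /X adjmxM adjmxK !mulmxA.
  have -> : adjmx (delta_mx i j) = delta_mx j i :> 'M[C]_d.
    by apply/matrixP => k l; rewrite !mxE andbC rmorph_nat.
  by rewrite [RHS]mxtrace_mulC !mulmxA trace_mul_delta mulmx_delta_mulmx.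
have Qge0 : 0 <= \sum_i \sum_j Q i j.
  apply: sumr_ge0 => i _; apply: sumr_ge0 => j _.
  by have [] := conj_mean_ge (X i j).
apply: (@le_trans _ _ (\tr K * \sum_i \sum_j Q i j)); last first.
  by rewrite ler_wpM2r// unit_trace_le.
rewrite mulr_sumr.
(* Because [T K = T], the trace of [X i j *m K] is the conjugate of [T i j]. *)
have -> : \tr (T *m adjmx T) = \sum_i \sum_j `|\tr (X i j *m K)| ^+ 2.
  rewrite trace_mul_adj; apply: eq_bigr => i _; apply: eq_bigr => j _.
  rewrite /X mxtrace_mulC mulmxA trace_mul_delta -{1}adjK1 -adjmxM TK adjmxE.
  by rewrite norm_conjC normCK.
apply: ler_sum => i _; rewrite mulr_sumr; apply: ler_sum => j _.
by have [] := conj_mean_ge (X i j).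
Qed.

End SpectralGap.
End InvariantMean.

(** * From orthogonality conditions to finite linear combinations *)

Section SpectralGapOrthogonal.
Variable C : numClosedFieldType.

Lemma mxvec_mul_adj m n (A B : 'M[C]_(m, n)) :
  mxvec A *m adjmx (mxvec B) = (\tr (A *m adjmx B))%:M.
Proof.
apply/matrixP => i j; rewrite !ord1 !mxE eqxx mulr1n trace_mul_adj pair_bigA/=.
rewrite (reindex _ (curry_mxvec_bij _ _)).
by apply: eq_bigr => -[k l] _; rewrite adjmxE /= !mxvecE.
Qed.

Lemma span_double_orthogonal (I : Type) m n (f : I -> 'M[C]_(m, n))
    (T : 'M[C]_(m, n)) :
  (forall X, (forall i, \tr (X *m adjmx (f i)) = 0) -> \tr (T *m adjmx X) = 0) ->
  exists s : seq (C * I), T = \sum_(ci <- s) ci.1 *: f ci.2.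
Proof.
move=> TX.
have [y fy|s Ts] :=
  @row_double_annihilator C I _ (fun i => mxvec (f i)) (mxvec T).
  (* Every column is the adjoint of a flattened matrix, so annihilation by columns is Frobenius
     orthogonality. *)
  have yX : y = adjmx (mxvec (vec_mx (adjmx y))) by rewrite vec_mxK adjmxK.
  move: (vec_mx _) yX fy => X {y}-> fX; rewrite mxvec_mul_adj TX ?raddf0// => i.
  rewrite -[X]adjmxK -adjmxM trace_adj; have /matrixP/(_ 0 0) := fX i.
  by rewrite mxvec_mul_adj !mxE mulr1n => ->; rewrite conjC0.
exists s; rewrite -[T]mxvecK Ts linear_sum; apply: eq_bigr => ci _.
by rewrite linearZ/= mxvecK.
Qed.

(** The condition on [T] places it in the double orthogonal complement of the [N g], hence in their
    span, as [frob_mean_ge] requires. *)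
Lemma centered_frob_mean_ge (G : groupType) (D : (G -> C) -> Prop)
    (E : (G -> C) -> C) (DE : invariant_mean D E) d (M : G -> 'M[C]_d)
    (DM : mx_dom D M) (MM : forall g h, M (g * h)%g = M g *m M h)
    (MV : forall g, M (g^-1)%g = adjmx (M g))
    (N : G -> 'M[C]_d := fun x => M x - mx_mean E M) (T : 'M[C]_d) :
  (forall X, (forall g, \tr (X *m adjmx (N g)) = 0) -> \tr (T *m adjmx X) = 0) ->
  \tr (T *m adjmx T) <=
    d%:R * E (fun x => \tr (T *m adjmx (N x)) * (\tr (T *m adjmx (N x)))^*).
Proof.
move=> /span_double_orthogonal[s Ts]; apply: (frob_mean_ge DE _ _ _ Ts).
- move=> i j.
  apply: (eq_dom (dom_add DE (DM i j) (dom_cst DE (- mx_mean E M i j)))).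
  by move=> x; rewrite !mxE.
- exact: (centered_mul DE DM MM MV).
- exact: (centered_inv DE DM MM MV).
Qed.

End SpectralGapOrthogonal.

(** * Integration of bounded complex functions *)

Section ComplexParts.
Variable R : realType.
Implicit Types x y : R[i].

Lemma Re_complexD x y : complex.Re (x + y) = complex.Re x + complex.Re y.
Proof. by case: x y => [? ?] []. Qed.

Lemma Im_complexD x y : complex.Im (x + y) = complex.Im x + complex.Im y.
Proof. by case: x y => [? ?] []. Qed.

Lemma Re_complexM x y :
  complex.Re (x * y) = complex.Re x * complex.Re y - complex.Im x * complex.Im y.
Proof. by case: x y => [? ?] []. Qed.

Lemma Im_complexM x y :
  complex.Im (x * y) = complex.Re x * complex.Im y + complex.Im x * complex.Re y.
Proof. by case: x y => [? ?] []. Qed.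

Lemma Re_complex_conj x : complex.Re (Num.conj x) = complex.Re x.
Proof. by case: x. Qed.

Lemma Im_complex_conj x : complex.Im (Num.conj x) = - complex.Im x.
Proof. by case: x. Qed.

Lemma Re_complexMn x k : complex.Re (x *+ k) = complex.Re x *+ k.
Proof. by elim: k => [//|k IH]; rewrite !mulrS Re_complexD IH. Qed.

End ComplexParts.

Section ComplexIntegral.
Context d (T : measurableType d) (R : realType) (mu : probability T R).

(** Unlike integrability, this condition is stable under products, and it implies integrability for
    a probability measure. *)
Definition bounded_measurable (f : T -> R) : Prop :=
  measurable_fun setT f /\ exists B, forall x, `|f x| <= B.

Lemma bounded_measurable_integrable f :
  bounded_measurable f -> mu.-integrable setT (EFin \o f).
Proof.
move=> [mf [B fB]]; apply: measurable_bounded_integrable => //.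
  by rewrite -ge0_fin_numE// fin_num_measure.
exists B; split; rewrite ?num_real// => M BM x _.
by apply: le_trans (fB x) (ltW BM).
Qed.

Lemma bounded_measurable_cst c : bounded_measurable (fun=> c).
Proof. by split; [exact: measurable_cst|exists `|c|]. Qed.

Lemma bounded_measurableD f g : bounded_measurable f -> bounded_measurable g ->
  bounded_measurable (fun x => f x + g x).
Proof.
move=> [mf [A fA]] [mg [B gB]]; split; first exact: measurable_funD.
by exists (A + B) => x; apply: le_trans (ler_normD _ _) (lerD _ _).
Qed.

Lemma bounded_measurableN f : bounded_measurable f ->
  bounded_measurable (fun x => - f x).
Proof.
move=> [mf [A fA]]; split; first exact: measurableT_comp.
by exists A => x; rewrite normrN.
Qed.

Lemma bounded_measurableM f g : bounded_measurable f -> bounded_measurable g ->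
  bounded_measurable (fun x => f x * g x).
Proof.
move=> [mf [A fA]] [mg [B gB]]; split; first exact: measurable_funM.
by exists (A * B) => x; rewrite normrM ler_pM.
Qed.

Definition cbounded_measurable (f : T -> R[i]) : Prop :=
  bounded_measurable (fun x => complex.Re (f x)) /\
  bounded_measurable (fun x => complex.Im (f x)).

Lemma bounded_measurableB f g : bounded_measurable f -> bounded_measurable g ->
  bounded_measurable (fun x => f x - g x).
Proof.
by move=> bf bg; apply: bounded_measurableD => //; apply: bounded_measurableN.
Qed.

Lemma cbounded_measurableD f g : cbounded_measurable f -> cbounded_measurable g ->
  cbounded_measurable (fun x => f x + g x).
Proof.
move=> [f1 f2] [g1 g2]; split.
  by under eq_fun do rewrite Re_complexD; exact: bounded_measurableD.
by under eq_fun do rewrite Im_complexD; exact: bounded_measurableD.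
Qed.

Lemma cbounded_measurableM f g : cbounded_measurable f -> cbounded_measurable g ->
  cbounded_measurable (fun x => f x * g x).
Proof.
move=> [f1 f2] [g1 g2]; split.
  under eq_fun do rewrite Re_complexM.
  by apply: bounded_measurableB; apply: bounded_measurableM.
under eq_fun do rewrite Im_complexM.
by apply: bounded_measurableD; apply: bounded_measurableM.
Qed.

Lemma cbounded_measurable_conj f : cbounded_measurable f ->
  cbounded_measurable (fun x => Num.conj (f x)).
Proof.
move=> [f1 f2]; split; first by under eq_fun do rewrite Re_complex_conj.
by under eq_fun do rewrite Im_complex_conj; exact: bounded_measurableN.
Qed.

Let bmi := bounded_measurable_integrable.

Lemma cintegral_cst c : cintegral mu (fun=> c) = c.
Proof.
have mu1 : (mu : {measure set T -> \bar R}) setT = 1%E := probability_setT mu.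
by rewrite /cintegral !Rintegral_cst// mu1/= !mulr1; case: c.
Qed.

Lemma cintegralD f g : cbounded_measurable f -> cbounded_measurable g ->
  cintegral mu (fun x => f x + g x) = cintegral mu f + cintegral mu g.
Proof.
move=> [/bmi f1 /bmi f2] [/bmi g1 /bmi g2]; rewrite /cintegral.
under eq_Rintegral do rewrite Re_complexD.
under [X in Complex _ X]eq_Rintegral do rewrite Im_complexD.
by rewrite !RintegralD.
Qed.

Lemma cintegralZ c f : cbounded_measurable f ->
  cintegral mu (fun x => c * f x) = c * cintegral mu f.
Proof.
move=> [f1 f2]; rewrite /cintegral.
under eq_Rintegral do rewrite Re_complexM.
under [X in Complex _ X]eq_Rintegral do rewrite Im_complexM.
rewrite RintegralB ?RintegralD ?RintegralZl//; try exact: bmi;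
  try by apply: bmi; apply: bounded_measurableM => //;
         exact: bounded_measurable_cst.
by case: c.
Qed.

Lemma cintegral_conj f : cbounded_measurable f ->
  cintegral mu (fun x => Num.conj (f x)) = Num.conj (cintegral mu f).
Proof.
move=> [f1 f2]; rewrite /cintegral.
under eq_Rintegral do rewrite Re_complex_conj.
under [X in Complex _ X]eq_Rintegral do rewrite Im_complex_conj -mulN1r.
by rewrite RintegralZl ?mulN1r//; exact: bmi.
Qed.

End ComplexIntegral.

Lemma continuous_borel_measurable (X Y : ptopologicalType) (f : X -> Y) :
  continuous f ->
  measurable_fun [set: borelType X] (f : borelType X -> borelType Y).
Proof.
move=> /continuousP cf; apply: (@measurability _ _ _ _ _
  (f : borelType X -> borelType Y) (@open Y)) => //.
move=> _ [U oU <-]; rewrite setTI; apply: sub_sigma_algebra; exact: cf.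
Qed.

(** Here the target is [R] with its own measurable structure instead of [borelType R]; open
    intervals generate it. *)
Lemma continuous_real_borel_measurable (R : realType) (X : ptopologicalType)
    (f : X -> R) :
  continuous f -> measurable_fun [set: borelType X] (f : borelType X -> R).
Proof.
move=> /continuousP cf; apply: (measurability _ (RGenOpens.measurableE R)).
move=> _ [_ [a [b ->] <-]]; rewrite setTI; apply: sub_sigma_algebra.
by apply: cf; exact: interval_open.
Qed.

(** * Haar integration as an invariant mean *)

Section Haar.
Context (R : realType) (n : nat) (G : lieGroupType R n).
Variables (mu : probability (borelType G) R) (mu_haar : is_haar mu).

Lemma continuous_mulg (h : G) : continuous (fun x : G => (h * x)%g).
Proof.
move=> x; apply: (@continuous_comp _ _ _ (fun y : G => (h, y))
  (fun xy : G * G => (xy.1 * xy.2)%g)).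
  by apply: cvg_pair; [exact: cvg_cst|exact: cvg_id].
exact: lie_mul_continuous.
Qed.

Lemma haar_Rintegral_shift (h : G) (f : G -> R) :
  bounded_measurable (f : borelType G -> R) ->
  Rintegral mu setT (fun x => f (h * x)%g) = Rintegral mu setT f.
Proof.
move=> bf; have [mf [B fB]] := bf.
pose phi : borelType G -> borelType G := fun x : G => (h * x)%g.
have mphi : measurable_fun setT phi.
  by apply: continuous_borel_measurable; exact: continuous_mulg.
have bfphi : bounded_measurable (f \o phi).
  by split; [exact: measurableT_comp|exists B => x; apply: fB].
rewrite /Rintegral; congr fine.
have E := @integral_pushforward _ _ _ _ R phi mphi mu setT (EFin \o f).
rewrite preimage_setT in E.
rewrite -[LHS]E//; last first.
- exact: bounded_measurable_integrable.
- exact/measurable_EFinP.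
apply: eq_measure_integral => A mA _; rewrite /pushforward/=.
have mphiA : measurable (phi @^-1` A) by rewrite -[phi @^-1` A]setTI; exact: mphi.
(* [is_haar] speaks of images: it is applied to the preimage of [A], whose translate by [h] is
   [A]. *)
rewrite -[LHS](mu_haar h mphiA).
congr (mu _); rewrite eqEsubset; split => x /=.
  by move=> [y ? <-].
by move=> Ax; exists (h^-1 * x)%g; rewrite /phi ?mulKVg// mulVKg.
Qed.

Lemma haar_invariant_mean :
  invariant_mean (@cbounded_measurable _ (borelType G) R) (cintegral mu).
Proof.
split.
- by move=> c; split; exact: bounded_measurable_cst.
- by move=> f g Df Dg; exact: (cbounded_measurableD Df Dg).
- by move=> f g Df Dg; exact: (cbounded_measurableM Df Dg).
- by move=> f Df; exact: (cbounded_measurable_conj Df).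
- exact: cintegral_cst.
- by move=> f g Df Dg; exact: (cintegralD mu Df Dg).
- by move=> c f Df; exact: (cintegralZ mu c Df).
- by move=> f Df; exact: (cintegral_conj mu Df).
move=> h f [f1 f2]; rewrite /cintegral.
by rewrite (haar_Rintegral_shift h f1) (haar_Rintegral_shift h f2).
Qed.
End Haar.

(** * Operators in an orthonormal basis *)

Section RealCauchySchwarz.
Context (R : realType) (U : vectType R) (dot : {dot U for idfun}).

Lemma dot_ge0 u : 0 <= dot u u.
Proof. by have [->|/neq0_dnorm_gt0/ltW//] := eqVneq u 0; rewrite linear0r. Qed.

Lemma dotC u v : dot u v = dot v u.
Proof. by rewrite hermC expr0 mul1r. Qed.

Lemma normr_dot_le u v :
  `|dot u v| <= Num.sqrt (dot u u) * Num.sqrt (dot v v).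
Proof.
rewrite -sqrtrM ?dot_ge0// -sqrtr_sqr ler_wsqrtr//.
have [->|/neq0_dnorm_gt0 v0] := eqVneq v 0.
  by rewrite !linear0r expr0n/= ?mulr0.
have := dot_ge0 (dot v v *: u - dot u v *: v).
rewrite linearBr !linearBl !linearZr_LR !linearZl_LR/= (dotC v u).
rewrite [X in 0 <= X -> _](_ : _ = dot v v * (dot u u * dot v v - dot u v ^+ 2));
  last by ring.
by rewrite pmulr_rge0// subr_ge0.
Qed.

End RealCauchySchwarz.

Section OrthonormalBasis.
Context (R : realType) (V : vectType R[i]) (form : {dot V for Num.conj}).
Variables (e : seq V) (e_onb : is_orthonormal_basis form e).

Lemma form_onb (i j : 'I_(size e)) : form e`_i e`_j = (i == j)%:R.
Proof.
have /andP[eb eo] := e_onb; have [ue eE] := orthonormalP eo.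
by rewrite eE ?mem_nth// nth_uniq.
Qed.

Lemma onb_expansion x : x = \sum_(i < size e) form x e`_i *: e`_i.
Proof.
have /andP[eb eo] := e_onb.
have xe := coord_basis (eb : basis_of fullv (in_tuple e)) (memvf x).
rewrite {1}xe; apply: eq_bigr => i _; congr (_ *: _).
rewrite {2}xe linear_sumlz (bigD1 i)//= big1 => [|j ji].
  by rewrite addr0 linearZl_LR/= form_onb eqxx mulr1.
by rewrite linearZl_LR/= form_onb (negPf ji) mulr0.
Qed.

Lemma form_parseval x y :
  form x y = \sum_(i < size e) form x e`_i * Num.conj (form y e`_i).
Proof.
rewrite {1}(onb_expansion x) linear_sumlz; apply: eq_bigr => i _.
by rewrite linearZl_LR/= [form e`_i y]hermC expr0 mul1r.
Qed.

(** Column [j] holds the coordinates of the image of the [j]-th basis vector, so composition becomes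
    the matrix product in the same order. *)
Definition op_mx (A : 'End(V)) : 'M[R[i]]_(size e) :=
  \matrix_(i, j) form (A e`_j) e`_i.

Lemma hs_dotE A B : hs_dot form e A B = \tr (op_mx A *m adjmx (op_mx B)).
Proof.
rewrite /hs_dot (big_nth 0) big_mkord trace_mul_adj exchange_big/=.
apply: eq_bigr => j _; rewrite form_parseval.
by apply: eq_bigr => i _; rewrite !mxE.
Qed.

Lemma op_mx_comp A B : op_mx (A \o B)%VF = op_mx A *m op_mx B.
Proof.
apply/matrixP => i j; rewrite !mxE comp_lfunE {1}(onb_expansion (B _)).
rewrite linear_sum linear_sumlz; apply: eq_bigr => k _.
by rewrite linearZ linearZl_LR/= !mxE mulrC.
Qed.

Lemma op_mxB A B : op_mx (A - B) = op_mx A - op_mx B.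
Proof. by apply/matrixP => i j; rewrite !mxE !lfunE/= lfunE linearBl. Qed.

Definition mx_op_fun (X : 'M[R[i]]_(size e)) (v : V) : V :=
  \sum_i (\sum_j X i j * form v e`_j) *: e`_i.

Fact mx_op_fun_linear X : linear (mx_op_fun X).
Proof.
move=> a u v; rewrite /mx_op_fun scaler_sumr -big_split/=.
apply: eq_bigr => i _; rewrite scalerA -scalerDl; congr (_ *: _).
rewrite mulr_sumr -big_split/=; apply: eq_bigr => j _.
by rewrite linearDl linearZl_LR/= mulrDr mulrCA.
Qed.

HB.instance Definition _ X := GRing.isLinear.Build R[i] V V _
  (mx_op_fun X) (mx_op_fun_linear X).

(** This turns orthogonality tests against matrices into tests against operators, as in
    [hs_orth]. *)
Lemma op_mx_surj X : exists A, op_mx A = X.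
Proof.
exists (linfun (mx_op_fun X)); apply/matrixP => i j; rewrite !mxE lfunE/=.
rewrite /mx_op_fun linear_sumlz (bigD1 i)//= [X in _ + X]big1 => [|k ki].
  rewrite addr0 linearZl_LR/= form_onb eqxx mulr1 (bigD1 j)//= big1 => [|k kj].
    by rewrite form_onb eqxx mulr1 addr0.
  by rewrite form_onb eq_sym (negPf kj) mulr0.
by rewrite linearZl_LR/= form_onb (negPf ki) mulr0.
Qed.

End OrthonormalBasis.

(** * Matrix coefficients of an orthogonal representation *)

Section OrthogonalRepresentation.
Context (R : realType) (n : nat) (G : lieGroupType R n) (U : vectType R).
Context (dot : {dot U for idfun}) (r : G -> 'End(U)).
Hypothesis r_orth : orthogonal_representation dot r.

Lemma normr_repr_dot_le g u v :
  `|dot (r g u) v| <= Num.sqrt (dot u u) * Num.sqrt (dot v v).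
Proof.
by apply: le_trans (normr_dot_le _ _ _) _; rewrite (repr_isometry r_orth).
Qed.

Lemma continuous_repr_dot u v : continuous (fun g => dot (r g u) v).
Proof.
move=> g; apply/cvgrPdist_le => eps eps0.
pose s := Num.sqrt (dot u u) * Num.sqrt (dot v v).
have s0 : 0 <= s by rewrite mulr_ge0 ?sqrtr_ge0.
(* Adding 1 keeps the denominator positive when [u] or [v] vanishes. *)
have d0 : 0 < eps / (1 + s) by rewrite divr_gt0// ltr_wpDr.
have := repr_continuous r_orth g d0; apply: filterS => h /(_ u) hu.
rewrite distrC -linearBl; apply: le_trans (normr_dot_le _ _ _) _.
apply: le_trans (ler_wpM2r (sqrtr_ge0 _) hu) _.
rewrite -mulrA -/s -mulrA ler_piMr ?(ltW eps0)//.
rewrite mulrC ler_pdivrMr ?mul1r ?ltr_wpDr//.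
by rewrite lerDr.
Qed.

Lemma bounded_measurable_repr_dot u v :
  bounded_measurable ((fun g => dot (r g u) v) : borelType G -> R).
Proof.
split.
  exact: (continuous_real_borel_measurable (continuous_repr_dot (v := v))).
exists (Num.sqrt (dot u u) * Num.sqrt (dot v v)) => g.
exact: normr_repr_dot_le.
Qed.

Local Notation rho := (fun g => complexify (r g)).

Lemma cbounded_measurable_repr_hdot (x y : complexified U) :
  cbounded_measurable ((fun g => hdot dot (rho g x) y) : borelType G -> R[i]).
Proof.
split.
  under eq_fun do rewrite lfunE/=.
  by apply: bounded_measurableD; exact: bounded_measurable_repr_dot.
under eq_fun do rewrite lfunE/=.
by apply: bounded_measurableB; exact: bounded_measurable_repr_dot.
Qed.

Lemma complexify_reprM g h : rho (g * h)%g = (rho g \o rho h)%VF.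
Proof.
apply/lfunP => x; rewrite !lfunE/= !lfunE/=.
by rewrite /complexify_fun (reprM r_orth) !lfunE.
Qed.

Lemma complexify_isometry g x y : hdot dot (rho g x) (rho g y) = hdot dot x y.
Proof.
by rewrite !lfunE/= /hdot /complexify_fun/= !(repr_isometry r_orth).
Qed.

Lemma complexify_reprVK g x : rho g (rho (g^-1)%g x) = x.
Proof.
rewrite -comp_lfunE -complexify_reprM mulgV (repr1 r_orth) lfunE/=.
by rewrite /complexify_fun !lfunE; case: x.
Qed.

Variables (e : seq (complexified U)) (e_onb : is_orthonormal_basis (hdot dot) e).
Local Notation M := (fun g => op_mx (hdot dot) e (rho g)).

Lemma op_mx_reprM g h : M (g * h)%g = M g *m M h.
Proof. by rewrite /= complexify_reprM op_mx_comp. Qed.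

(** Applying the isometry [rho g] to both arguments of the form moves the group element to the other
    side. *)
Lemma op_mx_reprV g : M (g^-1)%g = adjmx (M g).
Proof.
apply/matrixP => i j; rewrite adjmxE !mxE /= -[LHS](complexify_isometry g).
by rewrite complexify_reprVK [LHS]hermC expr0 mul1r.
Qed.

Lemma cbounded_measurable_op_mx :
  mx_dom (@cbounded_measurable _ (borelType G) R) M.
Proof.
move=> i j; apply: eq_dom (cbounded_measurable_repr_hdot e`_j e`_i) _ => g.
by rewrite mxE.
Qed.

End OrthogonalRepresentation.

(** * The variance of the Fourier map *)

Lemma expe2_poweR (R : realType) (x : \bar R) : (0 <= x)%E -> (x ^+ 2 = x `^ 2)%E.
Proof.
case: x => [x| |]//=; first by rewrite lee_fin => x0; rewrite powR_mulrn.
by move=> _; rewrite pnatr_eq0 mulyy.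
Qed.

Lemma L2_norm_sqr d (T : measurableType d) (R : realType) (mu : probability T R)
    (f : T -> R[i]) : cbounded_measurable f ->
  (L2_norm mu f ^+ 2)%E =
    (complex.Re (cintegral mu (fun x => f x * Num.conj (f x))))%:E.
Proof.
move=> bf.
have [bff _] := cbounded_measurableM bf (cbounded_measurable_conj bf).
rewrite expe2_poweR ?Lnorm_ge0// poweR_Lnorm//.
(* Boundedness makes the integral finite, so [fine] loses nothing. *)
rewrite [complex.Re _]/= /Rintegral fineK; last first.
  apply: integrable_fin_num => //; exact: bounded_measurable_integrable.
apply: eq_integral => x _.
rewrite poweR_EFin powR_mulrn; last exact: normr_ge0.
rewrite real_normK ?num_real// Re_complexM Re_complex_conj Im_complex_conj.
case: (f x) => a b /=; rewrite sqr_sqrtr ?addr_ge0 ?sqr_ge0//.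
by congr EFin; ring.
Qed.

Section FourierVariance.
Context (R : realType) (n : nat) (G : lieGroupType R n).
Variables (mu : probability (borelType G) R) (mu_haar : is_haar mu).
Context (U : vectType R) (dot : {dot U for idfun}) (r : G -> 'End(U)).
Hypothesis r_orth : orthogonal_representation dot r.
Variables (e : seq (complexified U)) (e_onb : is_orthonormal_basis (hdot dot) e).

Local Notation mx := (op_mx (hdot dot) e).
Local Notation rho := (fun g => complexify (r g)).
Local Notation C := (constant_set (hdot dot) e rho).
Local Notation M := (fun g => mx (rho g)).
Local Notation N := (fun g => mx (rho g) - mx_mean (cintegral mu) M).

(** The mean commutes with the trace and the adjoint, so subtracting the mean of [Phi T] amounts to
    centering [rho]. *)
Lemma PsiE T g : Psi mu (hdot dot) e rho T g = \tr (mx T *m adjmx (N g)).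
Proof.
have DE := haar_invariant_mean mu_haar.
have DM := cbounded_measurable_op_mx r_orth (e := e).
have Mad := mx_dom_adj DE DM.
rewrite /Psi /Phi hs_dotE// adjmxB mulmxBr raddfB/=; congr (_ - _).
rewrite (@eq_mean _ _ _ _ (fun g => \tr (mx T *m adjmx (M g)))); last first.
  by move=> h; rewrite hs_dotE.
rewrite (mean_trace DE) ?(mx_meanMl DE) ?(mx_mean_adj DE)//.
by apply: (mx_dom_mul DE) => //; exact: (mx_dom_cst DE).
Qed.

(** [Phi T] is constant exactly when it equals its mean, that is when [Psi T] vanishes. *)
Lemma constant_setE T : C T <-> forall g, \tr (mx T *m adjmx (N g)) = 0.
Proof.
split=> [[c Tc] g|T0].
  rewrite -PsiE /Psi Tc (_ : Phi _ _ _ T = fun=> c); last exact/funext.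
  by rewrite cintegral_cst subrr.
exists (cintegral mu (Phi (hdot dot) e rho T)) => g.
apply/eqP; rewrite -subr_eq0 -[X in X == _]/(Psi mu (hdot dot) e rho T g).
by rewrite PsiE T0.
Qed.

Lemma cbounded_measurable_Psi T :
  cbounded_measurable (Psi mu (hdot dot) e rho T : borelType G -> R[i]).
Proof.
have DE := haar_invariant_mean mu_haar.
have DM := cbounded_measurable_op_mx r_orth (e := e).
have Mad := mx_dom_adj DE DM.
apply: (dom_add DE); last exact: (dom_cst DE).
apply: (@eq_dom _ _ _ _ (fun g => \tr (mx T *m adjmx (M g)))); last first.
  by move=> g; rewrite /Phi hs_dotE.
by apply: (dom_trace DE); apply: (mx_dom_mul DE) => //; exact: (mx_dom_cst DE).
Qed.

(** Each [N g] is orthogonal to [C], and [T - P] is orthogonal to everything that is; pairing the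
    two gives [Psi] of the difference. *)
Lemma Psi_proj T P : hs_orth (hdot dot) e (hs_orth (hdot dot) e C) (T - P) ->
  Psi mu (hdot dot) e rho T = Psi mu (hdot dot) e rho P.
Proof.
move=> TP; apply/funext => g; apply/eqP; rewrite -subr_eq0 !PsiE -raddfB/=.
rewrite -mulmxBl -op_mxB.
have [X Xg] := op_mx_surj e_onb (N g); rewrite -Xg -hs_dotE// TP// => A AC.
rewrite hs_dotE// Xg -[N g]adjmxK -adjmxM trace_adj.
by move/constant_setE: AC => ->; rewrite conjC0.
Qed.

Lemma hs_norm_le T : hs_orth (hdot dot) e C T ->
  hs_norm (hdot dot) e T ^+ 2 <= (size e)%:R *
    complex.Re (cintegral mu (fun g => Psi mu (hdot dot) e rho T g *
                               Num.conj (Psi mu (hdot dot) e rho T g))).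
Proof.
move=> TC; have DE := haar_invariant_mean mu_haar.
have DM := cbounded_measurable_op_mx r_orth (e := e).
have TX X : (forall g, \tr (X *m adjmx (N g)) = 0) -> \tr (mx T *m adjmx X) = 0.
  have [A <-] := op_mx_surj e_onb X.
  by move=> /constant_setE AC; rewrite -hs_dotE// TC.
have := centered_frob_mean_ge DE DM (op_mx_reprM r_orth e_onb)
  (op_mx_reprV r_orth e) TX.
(* The order of [R[i]] requires equal imaginary parts and compares real parts; the comparison of
   real parts is kept. *)
rewrite lecE => /andP[_].
have Re_ge0 : 0 <= complex.Re (\tr (mx T *m adjmx (mx T))).
  by have := trace_mul_adj_ge0 (mx T); rewrite lecE => /andP[].
rewrite /hs_norm hs_dotE// sqr_sqrtr// => /le_trans; apply.
under [X in _ <= _ * complex.Re X]eq_mean do rewrite PsiE.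
by rewrite mulr_natl Re_complexMn mulr_natl.
Qed.

End FourierVariance.

Theorem theoremD3 (R : realType) (n : nat) (G : lieGroupType R n)
    (G_compact : compact [set: G])
    (mu : probability (borelType G) R) (mu_haar : is_haar mu)
    (U : vectType R) (dot : {dot U for idfun})
    (r : G -> 'End(U)) (r_orth : orthogonal_representation dot r)
    (e : seq (complexified U)) (e_onb : is_orthonormal_basis (hdot dot) e)
    (T : 'End(complexified U)) :
  let rho (g : G) : 'End(complexified U) := complexify (r g) in
  let C : set 'End(complexified U) := constant_set (hdot dot) e rho in
  (L2_norm mu (Psi mu (hdot dot) e rho T) ^+ 2 >=
   ((\dim {:U})%:R^-1 *
      hs_norm (hdot dot) e
        (hs_proj (hdot dot) e (hs_orth (hdot dot) e C) T) ^+ 2)%:E)%E.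
Proof.
cbv zeta; set rho := fun g => complexify (r g).
have L2_ge0 : (0 <= L2_norm mu (Psi mu (hdot dot) e rho T) ^+ 2)%E.
  by rewrite expe_ge0// Lnorm_ge0.
rewrite /hs_proj; case: xgetP => [P _ [PC TP]|_].
  (* In dimension 0 the convention that the inverse of 0 is 0 makes the lower bound 0. *)
  have [d0|d0] := posnP (\dim {:U}); first by rewrite d0 invr0 mul0r.
  rewrite (Psi_proj mu_haar r_orth e_onb TP) L2_norm_sqr; last first.
    exact: cbounded_measurable_Psi.
  rewrite lee_fin ler_pdivrMl ?ltr0n//.
  (* The complex dimension of [complexified U] is the real dimension of [U], by the construction of
     its vector space structure. *)
  have <- : size e = \dim {:U}.
    have /andP[eb _] := e_onb.
    by rewrite -(size_basis (eb : basis_of fullv (in_tuple e))) !dimvf.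
  exact: hs_norm_le.
(* In this branch [xget] returns its default [0], whose norm is 0, and [L2_ge0] concludes. *)
rewrite /hs_norm /hs_dot big1 => [|x _]; last by rewrite lfunE linear0l.
by rewrite sqrtr0 expr0n mulr0.
Qed.
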